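(* Let $n,r,s$ be positive integers and $k$ an integer. Suppose $(n,r+k-1)=1$, $(r,s)=1$, $r\neq s$, and $r\equiv s\bmod n$. Then $F(r,n,k,s)$ is the metacyclic group \[B\left((r^n-s^n)/n,\ n,\ (s\hat{r})^{\bar{A}},\ 1\right)\] of order $|r^n-s^n|$, where $(r+k-1)\bar{A}\equiv 1\bmod n$ and $r\hat{r}\equiv 1\bmod (r^n-s^n)$.
   Context: $(a,b)$ denotes the greatest common divisor. For a word $w$ in $x_0,\dots,x_{n-1}$, $G_n(w)=\langle x_0,\dots,x_{n-1}\mid w,\theta(w),\dots,\theta^{n-1}(w)\rangle$ where $\theta(x_i)=x_{i+1}$, subscripts modulo $n$. For $r,s>0$, $P(r,n,l,s,f)=G_n\big((x_0x_f\cdots x_{(r-1)f})(x_{(l-1)}x_{(l-1)+f}\cdots x_{(l-1)+(s-1)f})^{-1}\big)$, and $F(r,n,k,s)=P(r,n,r+k,s,1)$, i.e. $F(r,n,k,s)=G_n\big((x_0x_1\cdots x_{r-1})(x_{r+k-1}x_{r+k}\cdots x_{r+k+s-2})^{-1}\big)$. For integers $M,N,R,\lambda$ with $R^N\equiv 1\bmod M$, $B(M,N,R,\lambda)=\langle a,b\mid a^M=1,\ bab^{-1}=a^R,\ b^N=a^{\lambda M/(M,R-1)}\rangle$. The parameter $R$ matters only modulo $M$; powers of the unit $s\hat r$ with possibly negative exponents are read modulo $r^n-s^n$. A group is metacyclic if it has a cyclic normal subgroup with cyclic quotient. *)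

(* Defs.v *)
(* [boolp] turns equality in a presented group into a boolean relation, so that
   a possibly infinite group given by generators and relators can be formed as a
   quotient type. *)
From HB Require Import structures.
From mathcomp Require Import all_boot all_order all_algebra all_fingroup.
From mathcomp Require Import all_solvable.
From mathcomp Require Import boolp.

Set Implicit Arguments.
Unset Strict Implicit.
Unset Printing Implicit Defensive.

Import GRing.Theory.

Section Words.
Variable T : Type.

(* The letter (x, false) stands for x and (x, true) for x^-1; the product of
   words is concatenation and words are not assumed to be reduced. *)
Definition word := seq (T * bool).

Definition letter (x : T) : word := [:: (x, false)].

Definition word_inv (w : word) : word := rev [seq (p.1, ~~ p.2) | p <- w].

Definition word_exp (w : word) (z : int) : word :=
  match z with
  | Posz m => flatten (nseq m w)
  | Negz m => flatten (nseq m.+1 (word_inv w))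
  end.

(* The least congruence on words that contains free cancellation and makes
   every relator trivial. *)
Inductive pres_eq (rels : word -> Prop) : word -> word -> Prop :=
| pres_refl u : pres_eq rels u u
| pres_sym u v : pres_eq rels u v -> pres_eq rels v u
| pres_trans v u w : pres_eq rels u v -> pres_eq rels v w -> pres_eq rels u w
| pres_cat u u' v v' :
    pres_eq rels u u' -> pres_eq rels v v' -> pres_eq rels (u ++ v) (u' ++ v')
| pres_cancel x e : pres_eq rels [:: (x, e); (x, ~~ e)] [::]
| pres_rel w : rels w -> pres_eq rels w [::].

Lemma word_invK : involutive word_inv.
Proof.
move=> w; rewrite /word_inv map_rev revK -map_comp.
by rewrite (eq_map (g := id)) ?map_id // => -[x e] /=; rewrite negbK.
Qed.

Lemma word_inv_cat u v : word_inv (u ++ v) = word_inv v ++ word_inv u.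
Proof. by rewrite /word_inv map_cat rev_cat. Qed.

Lemma pres_mulV rels w : pres_eq rels (w ++ word_inv w) [::].
Proof.
elim: w => [|[x e] w IHw]; first exact: pres_refl.
rewrite -cat1s word_inv_cat -catA (catA w).
apply: pres_trans (pres_cancel rels x e).
apply: (pres_cat (u' := [:: (x, e)]) (v' := [:: (x, ~~ e)])).
  exact: pres_refl.
exact: (pres_cat IHw (pres_refl _ _)).
Qed.

Lemma pres_Vmul rels w : pres_eq rels (word_inv w ++ w) [::].
Proof. by have := pres_mulV rels (word_inv w); rewrite word_invK. Qed.

Lemma pres_inv rels u v :
  pres_eq rels u v -> pres_eq rels (word_inv u) (word_inv v).
Proof.
move=> uv; apply: pres_trans (_ : pres_eq rels (word_inv u ++ (v ++ word_inv v)) _).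
  rewrite -[X in pres_eq _ X]cats0; apply: pres_cat; first exact: pres_refl.
  exact/pres_sym/pres_mulV.
rewrite catA -[X in pres_eq _ _ X]cat0s.
apply: pres_cat; last exact: pres_refl.
apply: pres_trans (pres_Vmul rels u).
by apply: pres_cat; [exact: pres_refl | exact: pres_sym].
Qed.

End Words.

Section PresentedGroup.
Variables (T : choiceType) (rels : word T -> Prop).

Definition pres_eqb : rel (word T) := fun u v => `[< pres_eq rels u v >].

Lemma pres_eqb_refl : reflexive pres_eqb.
Proof. by move=> u; apply/asboolP/pres_refl. Qed.

Lemma pres_eqb_sym : symmetric pres_eqb.
Proof. by move=> u v; apply/asboolP/asboolP => /pres_sym. Qed.

Lemma pres_eqb_trans : transitive pres_eqb.
Proof. by move=> v u w /asboolP uv /asboolP vw; apply/asboolP/(pres_trans uv). Qed.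

Canonical pres_equiv :=
  EquivRel pres_eqb pres_eqb_refl pres_eqb_sym pres_eqb_trans.

Definition presented := {eq_quot pres_eqb}%qT.

HB.instance Definition _ := Choice.on presented.

Definition pres_class (w : word T) : presented := (\pi_({eq_quot pres_eqb}) w)%qT.
Definition pres_repr (g : presented) : word T := generic_quotient.repr (g : {eq_quot pres_eqb}%qT).

Lemma pres_reprK : cancel pres_repr pres_class.
Proof. by move=> g; apply: reprK. Qed.

Lemma pres_classP u v : pres_class u = pres_class v <-> pres_eq rels u v.
Proof.
split=> [/eqP|uv]; first by rewrite eqmodE => /asboolP.
by apply/eqP; rewrite eqmodE; apply/asboolP.
Qed.

Lemma pres_classK w : pres_eq rels (pres_repr (pres_class w)) w.
Proof. by apply/pres_classP; rewrite pres_reprK. Qed.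

Definition pres_mul (g h : presented) := pres_class (pres_repr g ++ pres_repr h).
Definition pres_one : presented := pres_class [::].
Definition pres_invg (g : presented) := pres_class (word_inv (pres_repr g)).

Lemma pres_class_cat u v :
  pres_class (u ++ v) = pres_mul (pres_class u) (pres_class v).
Proof. by apply/pres_classP/pres_cat; apply/pres_sym/pres_classK. Qed.

Lemma pres_class_inv u : pres_class (word_inv u) = pres_invg (pres_class u).
Proof. by apply/pres_classP/pres_inv/pres_sym/pres_classK. Qed.

Lemma pres_mulA : associative pres_mul.
Proof.
move=> g h k; rewrite -[g]pres_reprK -[h]pres_reprK -[k]pres_reprK.
by rewrite -!pres_class_cat catA.
Qed.

Lemma pres_mul1 : left_id pres_one pres_mul.
Proof. by move=> g; rewrite -[g]pres_reprK -pres_class_cat. Qed.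

Lemma pres_mulr1 : right_id pres_one pres_mul.
Proof. by move=> g; rewrite -[g]pres_reprK -pres_class_cat cats0. Qed.

Lemma pres_mulVg : left_inverse pres_one pres_invg pres_mul.
Proof.
move=> g; rewrite -[g]pres_reprK -pres_class_inv -pres_class_cat.
exact/pres_classP/pres_Vmul.
Qed.

Lemma pres_mulgV : right_inverse pres_one pres_invg pres_mul.
Proof.
move=> g; rewrite -[g]pres_reprK -pres_class_inv -pres_class_cat.
exact/pres_classP/pres_mulV.
Qed.

HB.instance Definition _ :=
  isGroup.Build presented pres_mulA pres_mul1 pres_mulr1 pres_mulVg pres_mulgV.

End PresentedGroup.

Definition isomorphic (G H : groupType) : Prop :=
  exists f : {multiplicative G -> H}, bijective f.

(* theta(x_i) = x_(i+1), where [ordS] is the cyclic successor on 'I_n. *)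
Definition theta n (w : word 'I_n) : word 'I_n := [seq (ordS p.1, p.2) | p <- w].

(* G_n(w) = < x_0, ..., x_(n-1) | w, theta(w), ..., theta^(n-1)(w) >. *)
Definition cyc_presented n (w : word 'I_n) : groupType :=
  presented (fun v : word 'I_n => exists2 j, j < n & v = iter j (@theta n) w).

Local Open Scope ring_scope.

Lemma cyc_index_subproof n (n_gt0 : (0 < n)%N) (z : int) :
  (`|(z %% n%:Z)%Z| < n)%N.
Proof.
have n_neq0 : n%:Z != 0 by rewrite -lt0n.
by rewrite -ltz_nat gez0_abs ?modz_ge0 // ltz_pmod.
Qed.

Definition cyc_index n (n_gt0 : (0 < n)%N) (z : int) : 'I_n :=
  Ordinal (cyc_index_subproof n_gt0 z).

(* x_i x_(i+f) ... x_(i+(m-1)f), with subscripts modulo n. *)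
Definition cyc_word n (n_gt0 : (0 < n)%N) (i f : int) (m : nat) : word 'I_n :=
  flatten [seq letter (cyc_index n_gt0 (i + j%:Z * f)) | j <- iota 0 m].

Definition groupP (r n : nat) (n_gt0 : (0 < n)%N) (l : int) (s : nat) (f : int) :
    groupType :=
  cyc_presented (cyc_word n_gt0 0 f r ++ word_inv (cyc_word n_gt0 (l - 1) f s)).

Definition groupF (r n : nat) (n_gt0 : (0 < n)%N) (k : int) (s : nat) : groupType :=
  groupP r n_gt0 (r%:Z + k) s 1.

(* < a, b | a^M = 1, b a b^-1 = a^R, b^N = a^(lambda M / (M, R - 1)) >; an
   equation u = v is encoded by the relator u v^-1. Such a presentation is only
   considered for R^N = 1 modulo M. *)
Definition groupB (M N R lambda : int) : groupType :=
  let a : word bool := letter false in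
  let b : word bool := letter true in
  presented (fun w : word bool =>
    [\/ w = word_exp a M,
        w = b ++ a ++ word_inv b ++ word_inv (word_exp a R)
      | w = word_exp b N
              ++ word_inv (word_exp a (lambda * M %/ gcdz M (R - 1))%Z)]).

(* [v] represents u^e modulo m, for [u] a unit modulo [m] and an exponent [e] of
   any sign. *)
Definition is_exp_mod (m u e v : int) : Prop :=
  match e with
  | Posz j => (v = u ^+ j %[mod m])%Z
  | Negz j => (v * u ^+ j.+1 = 1 %[mod m])%Z
  end.

(* Main.v *)
Require Import Defs.
From HB Require Import structures.
From mathcomp Require Import all_boot all_order all_algebra all_fingroup.
From mathcomp Require Import all_solvable.
From mathcomp Require Import boolp.

(** Put D = r^n - s^n, d = |D|, c = r + k - 1, q = s / r modulo D and
    rho = R = q^A, so that q = rho^c, rho^n = 1 modulo d and, as r = s modulo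
    n, rho = 1 modulo n.  The last two facts make
        u o v = u + rho^u v
    a well-defined group law on Z/d (a cyclic brace): rho^u depends on u modulo
    n only, and n divides d.  Both F(r,n,k,s) and B(M,n,R,1) are isomorphic to
    this group of order d.

    The cyclic presentation ([cyc_presented_iso]).  The map x_i |-> rho^(-i)
    sends x_i x_(i+1) ... x_(i+m-1) to rho^(-i) m, since the powers of rho
    telescope; the relation at i thus reads r = rho^(-c) s, which is the choice
    of rho.  To invert the map, write block i m for x_i ... x_(i+m-1) in any
    group satisfying the relations.  As r = s modulo n, consecutive copies of
    the relation can be chained: block i (m r) = block (i+c) (m s).  Chaining n
    times with m = 1 gives block i (r^n) = block i (s^n), hence block i d = 1,
    so that block i m depends on m modulo d only.  Since r is a unit, the
    chained relation then says block i w = block (i+c) (rho^c w), and since c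
    is a unit modulo n, block i w = block (i+1) (rho w) ([block_shift]).
    Therefore v |-> block 0 v is a morphism from the brace, and it sends
    rho^(-i) to x_i.

    The metacyclic presentation ([groupB_iso]).  In the brace the multiples of
    n form a normal subgroup on which o is +, of order M = D / n up to sign,
    and 1 acts on it as multiplication by rho.  Send b to 1 and a to alpha n
    with alpha a unit.  Then b^n goes to 1 + rho + ... + rho^(n-1), and what
    remains is to choose alpha such that this is (M / (M, R - 1)) alpha n.
    Let S = (r^n - s^n) / (r - s); it is a multiple n T of n.  The arithmetic
    gives (M, R - 1) = |r - s| ([gcdz_metacyclic_exponent]), whence
    M / (M, R - 1) = T up to the sign of r - s; and since the exponents c i
    run over all classes modulo n, the sum of the rho^i equals that of the
    q^i, which is r^(1-n) S ([geometric_sum_scaled]).  So alpha is r^(1-n) up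
    to sign.  The relations of B bring every word to the form a^i b^j with
    i < |M| and j < n, and distinct such pairs have distinct images. *)

Set Implicit Arguments.
Unset Strict Implicit.
Unset Printing Implicit Defensive.

Import GRing.Theory Num.Theory.

(** * Morphisms of groups and presented groups *)

Section GroupMorphisms.
Variables (G H : groupType) (f : {multiplicative G -> H}).
Local Open Scope group_scope.

Lemma morph_one : f 1 = 1.
Proof. by apply: (mulgI (f 1)); rewrite -gmulfM !mulg1. Qed.

Lemma morph_inv : {morph f : x / x^-1}.
Proof. by move=> x; apply/divg1_eq; rewrite invgK -gmulfM mulVg morph_one. Qed.

Lemma morph_inj : (forall x, f x = 1 -> x = 1) -> injective f.
Proof.
by move=> f1 x y xy; apply/divg1_eq/f1; rewrite gmulfM morph_inv xy mulgV.
Qed.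

End GroupMorphisms.

Section Evaluation.
Variable H : groupType.
Local Open Scope group_scope.

Definition expgz (x : H) (z : int) : H :=
  match z with Posz m => x ^+ m | Negz m => x^-1 ^+ m.+1 end.

(** Replaces the integer exponents of a presentation by natural ones when the
    base has finite order; residues modulo that order are all that matters. *)
Lemma expgz_eq (d k : nat) (x : H) (z : int) :
  0 < d -> x ^+ d = 1 -> (z = k%:Z %[mod d%:Z])%Z -> expgz x z = x ^+ k.
Proof.
move=> d_gt0 xd.
have modE (i j : nat) : i = j %[mod d] -> x ^+ i = x ^+ j.
  move=> ij; rewrite (divn_eq i d) (divn_eq j d) ij !expgnDr.
  by rewrite !(mulnC _ d) !expgnA xd !expg1n.
case: z => [m|m] /= zk; first by apply: modE; move: zk; rewrite !modz_nat => -[].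
rewrite expVgn; apply: mulg1_eq.
rewrite -expgnDr -[RHS](expg0 x); apply: modE; rewrite mod0n; apply/eqP.
move/eqP: zk; rewrite eqz_mod_dvd NegzE -opprD dvdzE abszN.
by rewrite -PoszD absz_nat.
Qed.

Variables (T : Type) (f : T -> H).

Fixpoint eval_word (w : word T) : H :=
  if w is (x, e) :: w' then (if e then (f x)^-1 else f x) * eval_word w' else 1.

Lemma eval_cat u v : eval_word (u ++ v) = eval_word u * eval_word v.
Proof. by elim: u => [|[x e] u IHu] /=; rewrite ?mul1g // IHu mulgA. Qed.

Lemma eval_inv w : eval_word (word_inv w) = (eval_word w)^-1.
Proof.
elim: w => [|[x e] w IHw] /=; first by rewrite invg1.
rewrite -cat1s word_inv_cat eval_cat IHw invgM /= mulg1.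
by case: e; rewrite /= ?invgK.
Qed.

Lemma eval_exp w z : eval_word (word_exp w z) = expgz (eval_word w) z.
Proof.
have E m u : eval_word (flatten (nseq m u)) = eval_word u ^+ m.
  by elim: m => // m IHm; rewrite /= eval_cat IHm -expgS.
by case: z => m; [exact: E | have := E m.+1 (word_inv w); rewrite eval_inv].
Qed.

(** A presented group satisfies its universal property because evaluation in a
    group where the relators hold respects every rule of [pres_eq]. *)
Lemma eval_pres_eq (rels : word T -> Prop) u v :
  (forall w, rels w -> eval_word w = 1) -> pres_eq rels u v ->
  eval_word u = eval_word v.
Proof.
move=> rels1; elim=> {u v} //.
- by move=> u v w _ -> _ ->.
- by move=> u u' v v' _ Eu _ Ev; rewrite !eval_cat Eu Ev.
- by move=> x [] /=; rewrite mulg1 ?mulgV ?mulVg.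
Qed.

End Evaluation.

Section UniversalProperty.
Variables (T : choiceType) (rels : word T -> Prop) (H : groupType).
Local Open Scope group_scope.

Lemma pres_classM u v :
  pres_class rels (u ++ v) = pres_class rels u * pres_class rels v.
Proof. exact: pres_class_cat. Qed.

Lemma pres_classV u : pres_class rels (word_inv u) = (pres_class rels u)^-1.
Proof. exact: pres_class_inv. Qed.

Lemma eval_pres_class w :
  eval_word (fun x => pres_class rels (letter x)) w = pres_class rels w.
Proof.
elim: w => // -[x e] w IHw /=; rewrite IHw -cat1s pres_classM; congr (_ * _).
by case: e => //; rewrite -pres_classV.
Qed.

Lemma eval_rel w :
  rels w -> eval_word (fun x => pres_class rels (letter x)) w = 1.
Proof. by move=> rw; rewrite eval_pres_class; apply/pres_classP/pres_rel. Qed.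

Lemma pres_lift (f : T -> H) :
  (forall w, rels w -> eval_word f w = 1) ->
  exists F : {multiplicative presented rels -> H},
    forall w, F (pres_class rels w) = eval_word f w.
Proof.
move=> rels1; pose F (g : presented rels) := eval_word f (pres_repr g).
have FE w : F (pres_class rels w) = eval_word f w.
  exact: (eval_pres_eq rels1 (pres_classK rels w)).
have FM : {morph F : x y / x * y}.
  by move=> x y; have := FE (pres_repr x ++ pres_repr y); rewrite eval_cat.
pose m := isMultiplicative.Build _ _ F FM.
pose F' : {multiplicative presented rels -> H} := HB.pack F m.
by exists F'.
Qed.

Lemma pres_hom_eval (F : {multiplicative presented rels -> H}) w :
  F (pres_class rels w) = eval_word (fun x => F (pres_class rels (letter x))) w.
Proof.
rewrite -eval_pres_class; elim: w => [|[x e] w IHw] /=; first exact: morph_one.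
by rewrite gmulfM IHw; case: e; rewrite ?morph_inv.
Qed.

End UniversalProperty.

Lemma isomorphic_sym (G H : groupType) : isomorphic G H -> isomorphic H G.
Proof.
case=> f [g fK gK]; have gM := can2_gmulfM fK gK.
pose m := isMultiplicative.Build _ _ g gM.
pose g' : {multiplicative H -> G} := HB.pack g m.
by exists g'; exists f.
Qed.

Lemma isomorphic_trans (G H K : groupType) :
  isomorphic G H -> isomorphic H K -> isomorphic G K.
Proof. by case=> f bf [g bg]; exists (g \o f); apply: bij_comp. Qed.

Lemma isomorphic_inj_surj (G H : groupType) (f : {multiplicative G -> H}) :
  (forall x, f x = 1%g -> x = 1%g) -> (forall y, exists x, f x = y) ->
  isomorphic G H.
Proof.
move=> /morph_inj f_inj f_surj; exists f.
have ex y : exists x, f x == y by case: (f_surj y) => x <-; exists x.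
have gK : cancel (fun y => xchoose (ex y)) f.
  by move=> y; exact/eqP/(xchooseP (ex y)).
by exists (fun y => xchoose (ex y)) => // x; apply: f_inj; rewrite gK.
Qed.

(** * Congruences of natural numbers *)

Lemma eqn_mod_dvd d n u v : n %| d -> u = v %[mod d] -> u = v %[mod n].
Proof. by move=> nd uv; rewrite -(modn_dvdm u nd) uv modn_dvdm. Qed.

Lemma eq_addn_mod d u u' v v' :
  u = u' %[mod d] -> v = v' %[mod d] -> u + v = u' + v' %[mod d].
Proof. by move=> Eu Ev; rewrite -modnDm Eu Ev modnDm. Qed.

Lemma eq_muln_mod d u u' v v' :
  u = u' %[mod d] -> v = v' %[mod d] -> u * v = u' * v' %[mod d].
Proof. by move=> Eu Ev; rewrite -modnMm Eu Ev modnMm. Qed.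

Lemma eq_expn_base_mod d j u u' :
  u = u' %[mod d] -> u ^ j = u' ^ j %[mod d].
Proof. by move=> Eu; rewrite -modnXm Eu modnXm. Qed.

Lemma eq_expn_mod d n rho u v :
  rho ^ n = 1 %[mod d] -> u = v %[mod n] -> rho ^ u = rho ^ v %[mod d].
Proof.
move=> rhoX uv.
have E q t : rho ^ (q * n + t) = rho ^ t %[mod d].
  rewrite -[RHS]/(_ %% _) -[in RHS](mul1n (rho ^ t)) expnD; apply: eq_muln_mod => //.
  by rewrite mulnC expnM (eq_expn_base_mod _ rhoX) exp1n.
by rewrite (divn_eq u n) (divn_eq v n) uv !E.
Qed.

(** Multiplicative inverses come from the Chinese remainder theorem: the number
    that is 0 modulo [a] and 1 modulo [d] is a multiple of [a]. *)
Lemma inv_mod_coprime d a : coprime a d -> exists b, a * b = 1 %[mod d].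
Proof.
move=> co_ad; pose u := chinese a d 0 1.
have /dvdnP[b Eb] : a %| u by rewrite /dvdn chinese_modl // mod0n.
by exists b; rewrite mulnC -Eb chinese_modr.
Qed.

(** * The cyclic brace *)

(** The two congruences on [br_rho] are what the law u o v = u + rho^u v on Z/d
    needs: the first makes v |-> rho^v a morphism for o, the second makes it
    well defined on residues. *)
Record brace_data := BraceData {
  br_n : nat;
  br_d : nat;
  br_rho : nat;
  br_n_gt0 : 0 < br_n;
  br_d_gt0 : 0 < br_d;
  br_n_dvd_d : br_n %| br_d;
  br_rho_n : br_rho = 1 %[mod br_n];
  br_rho_exp : br_rho ^ br_n = 1 %[mod br_d] }.

Definition brace (p : brace_data) : Type := 'I_(br_d p).
HB.instance Definition _ p := Finite.on (brace p).

Section Brace.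
Variable p : brace_data.
Notation n := (br_n p).
Notation d := (br_d p).
Notation rho := (br_rho p).

Definition res (v : nat) : brace p := Ordinal (ltn_pmod v (br_d_gt0 p)).

Lemma res_eq u v : res u = res v <-> u = v %[mod d].
Proof. by split=> [[]|uv] //; apply: val_inj. Qed.

Lemma resK (v : brace p) : res (v : 'I_d) = v.
Proof. by apply: val_inj => /=; rewrite modn_small. Qed.

Lemma eq_rho_exp u v : u = v %[mod n] -> rho ^ u = rho ^ v %[mod d].
Proof. exact/eq_expn_mod/br_rho_exp. Qed.

Lemma rho_exp_n j : rho ^ j = 1 %[mod n].
Proof. by rewrite (eq_expn_base_mod _ (br_rho_n p)) exp1n. Qed.

Lemma rho_mul_n j v : rho ^ j * v = v %[mod n].
Proof. by rewrite -modnMml rho_exp_n modnMml mul1n. Qed.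

Definition brace_mul (u v : brace p) : brace p :=
  res ((u : 'I_d) + rho ^ (u : 'I_d) * (v : 'I_d)).

(** The inverse of v is - rho^(-v) v; the factors [d.-1] and [n.-1] stand for
    the two minus signs. *)
Definition brace_inv (v : brace p) : brace p :=
  res ((rho ^ ((n.-1) * (v : 'I_d))) * (d.-1 * (v : 'I_d))).

Lemma brace_mulE u v : brace_mul (res u) (res v) = res (u + rho ^ u * v).
Proof.
apply/res_eq/eq_addn_mod; first by rewrite /= modn_mod.
apply: eq_muln_mod; last by rewrite /= modn_mod.
by apply: eq_rho_exp; rewrite /= modn_dvdm ?br_n_dvd_d.
Qed.

(** Both sides expand to u + rho^u v + rho^(u + v) w, up to the replacement of
    rho^u v by v in an exponent, which rho = 1 modulo n permits. *)
Lemma brace_mulA : associative brace_mul.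
Proof.
move=> u v w; rewrite -[u]resK -[v]resK -[w]resK.
set u' := nat_of_ord u; set v' := nat_of_ord v; set w' := nat_of_ord w.
rewrite !brace_mulE; apply/res_eq.
rewrite mulnDr addnA mulnA -expnD; apply/eq_addn_mod => //; apply/eq_muln_mod => //.
by apply: eq_rho_exp; apply: eq_addn_mod => //; rewrite rho_mul_n.
Qed.

Lemma brace_mul1 : left_id (res 0) brace_mul.
Proof. by move=> v; rewrite -[v]resK brace_mulE expn0 mul1n. Qed.

Lemma brace_mulV : left_inverse (res 0) brace_inv brace_mul.
Proof.
move=> v; rewrite -[X in brace_mul _ X]resK brace_mulE; apply/res_eq.
set v' := nat_of_ord v; set e := n.-1 * v'.
have E : rho ^ (rho ^ e * (d.-1 * v')) = rho ^ e %[mod d].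
  apply: eq_rho_exp; rewrite rho_mul_n; apply/eqP.
  rewrite -(eqn_modDr v') -!mulSnr !prednK ?br_n_gt0 ?br_d_gt0 //.
  by rewrite -modnMml (eqP (br_n_dvd_d p)) mul0n modnMr mod0n.
rewrite -(eq_addn_mod (erefl _) (eq_muln_mod (esym E) (erefl _))).
by rewrite -mulnDr -mulSnr prednK ?br_d_gt0 // -mulnCA modnMr mod0n.
Qed.

End Brace.

HB.instance Definition _ p :=
  Finite_isGroup.Build (brace p) (@brace_mulA p) (@brace_mul1 p) (@brace_mulV p).

Section BraceGroup.
Variable p : brace_data.
Notation n := (br_n p).
Notation d := (br_d p).
Notation rho := (br_rho p).
Local Open Scope group_scope.

Lemma res_mul u v : res p u * res p v = res p (u + rho ^ u * v)%N.
Proof. exact: brace_mulE. Qed.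

Lemma res_expn x j : res p (x * n) ^+ j = res p (j * (x * n)).
Proof.
elim: j => [//|j IHj]; rewrite expgS IHj res_mul; apply/res_eq.
rewrite mulSn; apply: eq_addn_mod => //.
rewrite -[in RHS](mul1n (j * _)%N); apply: eq_muln_mod => //.
by rewrite -(expn0 rho); apply: eq_rho_exp; rewrite modnMl mod0n.
Qed.

Definition geom j := (\sum_(i < j) rho ^ i)%N.

Lemma res1_exp j : res p 1 ^+ j = res p (geom j).
Proof.
elim: j => [|j IHj]; first by rewrite /geom big_ord0.
rewrite expgS IHj res_mul; apply/res_eq; rewrite /geom big_ord_recl big_distrr /=.
by rewrite expn1; congr ((_ + _) %% _)%N; apply: eq_bigr => i _; rewrite -expnS.
Qed.

Lemma geom_mod_n j : geom j = j %[mod n].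
Proof.
rewrite /geom; elim: j => [|j IHj]; first by rewrite big_ord0.
by rewrite big_ord_recr /= -[in RHS]addn1; apply: eq_addn_mod => //; apply: rho_exp_n.
Qed.

Lemma res_conj x : res p 1 * res p (x * n) = res p (x * n) ^+ rho * res p 1.
Proof.
rewrite res_expn !res_mul expn1; apply/res_eq; rewrite addnC.
apply: eq_addn_mod => //; rewrite muln1 -(expn0 rho).
by apply: eq_rho_exp; rewrite mulnA modnMl mod0n.
Qed.

(** The power of [res p 1] (the identity is [res p 0]) fixes the residue modulo
    n; what is left is a multiple of n, that is, a power of alpha n. *)
Lemma res_factor alpha (v : brace p) : coprime alpha d ->
  exists i j, v = res p (alpha * n) ^+ i * res p 1 ^+ j.
Proof.
move=> /inv_mod_coprime [beta Eb].
pose v' : nat := nat_of_ord v; pose j := (v' %% n)%N.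
(* Multiplication by d.-1 is negation modulo d. *)
have /dvdnP[t Et] : n %| v' + d.-1 * geom j.
  have Eg : v' = geom j %[mod n] by rewrite geom_mod_n modn_mod.
  rewrite /dvdn (eq_addn_mod Eg (erefl _)) -mulSn.
  by rewrite prednK ?br_d_gt0 // -modnMml (eqP (br_n_dvd_d p)) mul0n mod0n.
exists (beta * t)%N, j.
rewrite res_expn res1_exp res_mul -[LHS]resK; apply/res_eq; rewrite -/v'.
have -> : (beta * t * (alpha * n) = (alpha * beta) * (v' + d.-1 * geom j))%N.
  by rewrite Et mulnACA (mulnC beta).
have -> : v' = v' + d.-1 * geom j + geom j %[mod d].
  by rewrite -addnA -mulSnr prednK ?br_d_gt0 // -modnDmr modnMr addn0.
apply: eq_addn_mod.
  by rewrite -[LHS]/(_ %% _)%N -[in LHS](mul1n (_ + _)%N); apply: eq_muln_mod.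
rewrite -[in LHS](mul1n (geom j)); apply: eq_muln_mod => //.
by rewrite -(expn0 rho); apply: eq_rho_exp; rewrite Et mulnA modnMl mod0n.
Qed.

(** The kernel form of uniqueness in [res_factor]: reduction modulo n isolates
    the exponent of [res p 1], since [geom j] is j modulo n. *)
Lemma res_factor1 alpha i j : coprime alpha d -> j < n ->
  res p (alpha * n) ^+ i * res p 1 ^+ j = 1 -> j = 0%N /\ d %| i * n.
Proof.
move=> co_alpha j_lt; rewrite res_expn res1_exp res_mul => /res_eq; rewrite mod0n.
have E0 k : rho ^ (i * (alpha * n)) * k = k %[mod d].
  rewrite -[in RHS](mul1n k); apply: eq_muln_mod => //.
  by rewrite -(expn0 rho); apply: eq_rho_exp; rewrite mulnA modnMl mod0n.
rewrite (eq_addn_mod (erefl _) (E0 (geom j))) => E.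
have j0 : j = 0%N.
  rewrite -(modn_small j_lt) -(geom_mod_n j) -(mod0n n).
  have := eqn_mod_dvd (br_n_dvd_d p) (etrans E (esym (mod0n d))).
  by rewrite mulnA modnMDl.
split=> //; move: E; rewrite j0 /geom big_ord0 addn0 mulnCA => /eqP.
by rewrite -/(dvdn _ _) Gauss_dvdr // coprime_sym.
Qed.

Lemma brace_metacyclic : metacyclic [set: brace p].
Proof.
pose a := res p (1 * n); pose b := res p 1.
have gen : [set: brace p] = <[a]> <*> <[b]>.
  apply/eqP; rewrite eq_sym eqEsubset subsetT; apply/subsetP => v _.
  have [//|i [j ->]] := @res_factor 1 v; first exact: coprime1n.
  by rewrite groupM // mem_gen // inE mem_cycle ?orbT.
have nab : <[b]> \subset 'N(<[a]>).
  rewrite cycle_subG -groupV inE -cycleJ cycle_subG conjgE invgK.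
  by rewrite mulgA res_conj mulgK mem_cycle.
apply/metacyclicP; exists <[a]>%G; rewrite cycle_cyclic gen normalYl nab.
by rewrite quotientYidl // quotient_cyclic // cycle_cyclic.
Qed.

End BraceGroup.

(** * Consequences of the cyclic relations *)

Section Blocks.
Variables (H : groupType) (X : nat -> H).
Local Open Scope group_scope.

Definition block i m : H := \prod_(j <- iota i m) X j.

Lemma block1 i : block i 1 = X i.
Proof. exact: big_seq1. Qed.

Lemma blockD i u v : block i (u + v) = block i u * block (i + u) v.
Proof. by rewrite /block iotaD big_cat. Qed.

Variables (n c r s d rho : nat).
Hypothesis n_gt0 : 0 < n.
Hypothesis X_mod : forall i j, i = j %[mod n] -> X i = X j.
Hypothesis rs_mod : r = s %[mod n].
Hypothesis X_rel : forall i, block i r = block (i + c) s.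
Hypothesis n_dvd_d : n %| d.
Hypothesis d_eq : (r ^ n = s ^ n + d \/ s ^ n = r ^ n + d)%N.
Hypothesis co_rd : coprime r d.
Hypothesis rho_c : (rho ^ c * r = s %[mod d])%N.
Hypothesis rho_n : (rho ^ n = 1 %[mod d])%N.
Hypothesis co_cn : coprime c n.

Lemma block_mod i j m : i = j %[mod n] -> block i m = block j m.
Proof.
move=> ij; rewrite /block -(addn0 i) -(addn0 j) !iotaDl !big_map.
by apply: eq_bigr => k _; apply/X_mod/eq_addn_mod.
Qed.

(** Concatenating m copies of the relation is legitimate because the two sides
    advance the index by the same amount modulo n. *)
Lemma block_scale i m : block i (m * r) = block (i + c) (m * s).
Proof.
elim: m i => [|m IHm] i; first by rewrite !mul0n /block !big_nil.
rewrite !mulSn !blockD X_rel IHm; congr (_ * _); apply: block_mod.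
by rewrite addnAC; apply: eq_addn_mod.
Qed.

Lemma block_scale_iter i j m :
  block i (m * r ^ j) = block (i + j * c) (m * s ^ j).
Proof.
elim: j i m => [|j IHj] i m; first by rewrite mul0n addn0 !expn0.
rewrite expnS mulnA IHj mulnAC block_scale -addnA -mulSnr expnSr.
by rewrite -mulnA.
Qed.

(** The n-fold iterate shifts the index by n c, that is, not at all; so a block
    of length r^n equals the block of length s^n with the same start, and the
    shorter one cancels. *)
Lemma block_period0 i : block i d = 1.
Proof.
have E k : block k (r ^ n) = block k (s ^ n).
  rewrite -(mul1n (r ^ n)%N) block_scale_iter mul1n.
  by apply: block_mod; rewrite addnC mulnC modnMDl.
(* The cancellation leaves a block starting at k + t; every index i has that
   form modulo n, with k = i + (n - 1) t. *)
have P t : (forall k, block (k + t) d = 1) -> block i d = 1.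
  move=> /(_ (i + n.-1 * t)%N) <-.
  apply: block_mod; rewrite -addnA -mulSnr prednK //.
  by rewrite addnC mulnC modnMDl.
case: d_eq => D; [apply: (P (s ^ n)%N) => k | apply: (P (r ^ n)%N) => k].
  by have := E k; rewrite D blockD -[RHS]mulg1 => /mulgI.
by have := esym (E k); rewrite D blockD -[RHS]mulg1 => /mulgI.
Qed.

Lemma block_mod_size i u v : u = v %[mod d] -> block i u = block i v.
Proof.
have E w t : block i (w * d + t) = block i t.
  elim: w => [//|w IHw]; rewrite mulSn -addnA blockD block_period0 mul1g -IHw.
  by apply: block_mod; rewrite -modnDmr (eqP n_dvd_d) addn0.
by move=> uv; rewrite (divn_eq u d) (divn_eq v d) uv !E.
Qed.

(** Shifting the index by one acts on lengths as division by rho.  This is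
    [block_scale] with r inverted modulo d, iterated until the shift c has
    become 1 modulo n. *)
Lemma block_shift i w : block i w = block i.+1 (rho * w).
Proof.
have [rhat Er] := inv_mod_coprime co_rd.
have Ec k u : block k u = block (k + c) (rho ^ c * u).
  have Eu : (u = (rhat * u) * r %[mod d])%N.
    rewrite mulnAC -[in LHS](mul1n u) (mulnC rhat).
    exact/esym/eq_muln_mod.
  rewrite (block_mod_size _ Eu) block_scale; apply: block_mod_size.
  rewrite (eq_muln_mod (erefl (rho ^ c %% d)%N) Eu) mulnCA.
  by apply: eq_muln_mod.
have Ej j : block i w = block (i + j * c) (rho ^ (j * c) * w).
  elim: j => [|j IHj]; first by rewrite addn0 mul1n.
  by rewrite IHj Ec mulnA -expnD -addnA -mulSn -mulSnr.
have [j Ejc] := inv_mod_coprime co_cn.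
rewrite (Ej j) -addn1; rewrite (mulnC j); rewrite (block_mod (j := i + 1)%N).
  apply: block_mod_size; apply: eq_muln_mod => //.
  by rewrite -[in RHS](expn1 rho); apply: eq_expn_mod rho_n _.
exact: eq_addn_mod.
Qed.

Lemma block_brace_mul u v :
  block 0 u * block 0 v = block 0 (u + rho ^ u * v).
Proof.
rewrite blockD add0n; congr (_ * _).
by elim: u => [|u IHu]; rewrite ?mul1n // IHu expnS -mulnA -block_shift.
Qed.

(** The exponent [n.-1 * i] represents - i, as rho^n = 1. *)
Lemma block_generator i : block 0 (rho ^ (n.-1 * i)) = X i.
Proof.
have E k u : block 0 u = block k (rho ^ k * u).
  by elim: k => [|k ->]; rewrite ?mul1n // block_shift mulnA -expnS.
rewrite (E i) -expnD -mulSn prednK // -block1; apply: block_mod_size.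
by rewrite mulnC -(expn0 rho); apply: eq_expn_mod rho_n _; rewrite modnMl mod0n.
Qed.

End Blocks.

(** * The cyclically presented group is the brace *)

Section CyclicWords.
Variables (n : nat) (n_gt0 : 0 < n).
Local Open Scope ring_scope.

Lemma cyc_index_eq z z' :
  (z = z' %[mod n%:Z])%Z -> cyc_index n_gt0 z = cyc_index n_gt0 z'.
Proof. by move=> zz'; apply: val_inj; rewrite /= zz'. Qed.

Lemma cyc_index_nat i : cyc_index n_gt0 i%:Z = (i %% n)%N :> nat.
Proof. by rewrite /= modz_nat absz_nat. Qed.

Lemma cyc_index_ord (i : 'I_n) : cyc_index n_gt0 (i : nat)%:Z = i.
Proof. by apply: val_inj; rewrite /= modz_nat absz_nat modn_small. Qed.

Lemma ordS_cyc_index z : ordS (cyc_index n_gt0 z) = cyc_index n_gt0 (z + 1).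
Proof.
apply: val_inj => /=; apply/eqP; rewrite -eqz_nat -modz_nat.
have nz : n%:Z != 0 by rewrite eqz_nat -lt0n.
rewrite !gez0_abs ?modz_ge0 // -addn1 PoszD gez0_abs ?modz_ge0 //.
by rewrite modzDml.
Qed.

Lemma theta_cyc_word z m :
  theta (cyc_word n_gt0 z 1 m) = cyc_word n_gt0 (z + 1) 1 m.
Proof.
rewrite /theta /cyc_word map_flatten -map_comp; congr flatten.
by apply: eq_map => j /=; rewrite ordS_cyc_index addrAC.
Qed.

Lemma iter_theta_relator j z z' m m' :
  iter j (@theta n) (cyc_word n_gt0 z 1 m ++ word_inv (cyc_word n_gt0 z' 1 m'))
  = cyc_word n_gt0 (z + j%:Z) 1 m ++ word_inv (cyc_word n_gt0 (z' + j%:Z) 1 m').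
Proof.
elim: j => [|j IHj]; first by rewrite !addr0.
rewrite iterS IHj /theta map_cat /word_inv map_rev -map_comp.
have := theta_cyc_word (z + j%:Z) m; have := theta_cyc_word (z' + j%:Z) m'.
by rewrite -!addrA -!PoszD addn1 => <- <-; rewrite /theta -map_comp.
Qed.

Lemma eval_cyc_word (H : groupType) (f : 'I_n -> H) z i m :
  (z = i%:Z %[mod n%:Z])%Z ->
  eval_word f (cyc_word n_gt0 z 1 m)
  = block (fun j => f (cyc_index n_gt0 j%:Z)) i m.
Proof.
move=> zi; rewrite /cyc_word /block -(addn0 i) iotaDl big_map.
elim: (iota 0 m) => [|j l IHl]; first by rewrite big_nil.
rewrite big_cons -IHl /=; congr (f _ * _)%g; apply: cyc_index_eq.
by rewrite mulr1 PoszD -modzDml zi modzDml.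
Qed.

End CyclicWords.

Section CyclicallyPresentedBrace.
Variables (p : brace_data) (r s c : nat) (k : int).
Notation n := (br_n p).
Notation d := (br_d p).
Notation rho := (br_rho p).
Hypothesis c_def : (r%:Z + k - 1 = c%:Z %[mod n%:Z])%Z.
Hypothesis rho_c : rho ^ c * r = s %[mod d].
Hypothesis rs_mod : r = s %[mod n].
Hypothesis d_eq : r ^ n = s ^ n + d \/ s ^ n = r ^ n + d.
Hypothesis co_rd : coprime r d.
Hypothesis co_cn : coprime c n.

Lemma eval_relator (H : groupType) (f : 'I_n -> H) j :
  let X i := f (cyc_index (br_n_gt0 p) i%:Z) in
  eval_word f (iter j (@theta n)
    (cyc_word (br_n_gt0 p) 0 1 r
       ++ word_inv (cyc_word (br_n_gt0 p) (r%:Z + k - 1) 1 s)))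
  = (block X j r * (block X (j + c) s)^-1)%g.
Proof.
move=> X; rewrite iter_theta_relator eval_cat eval_inv.
rewrite (eval_cyc_word _ _ _ (i := j)) ?add0r //.
rewrite (eval_cyc_word _ _ _ (i := j + c)) //.
by rewrite -modzDml c_def modzDml -PoszD addnC.
Qed.

Let x (i : 'I_n) : brace p := res p (rho ^ (n.-1 * i)).

(** In u o v = u + rho^u v the first letter rho^(-i) acts as rho, because it is
    1 modulo n; it turns the value rho^(-i-1) m of the remaining block into
    rho^(-i) m. *)
Lemma block_brace i m :
  block (fun j => x (cyc_index (br_n_gt0 p) j%:Z)) i m
  = res p (rho ^ (n.-1 * i) * m).
Proof.
elim: m i => [|m IHm] i; first by rewrite /block big_nil muln0.
rewrite -add1n blockD block1 IHm res_mul /x cyc_index_nat; apply/res_eq.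
rewrite (mulnDr (rho ^ _)) muln1; apply: eq_addn_mod.
  by apply: eq_rho_exp; apply: eq_muln_mod => //; rewrite modn_mod.
rewrite mulnA; apply: eq_muln_mod => //; rewrite -expnD; apply: eq_rho_exp.
rewrite (eq_addn_mod (rho_exp_n p _) (erefl _)) mulnDr muln1 addnCA addnC.
by rewrite add1n prednK ?br_n_gt0 // modnDl.
Qed.

(** The morphism out of the presented group is injective because [psi], a
    morphism as well, sends each image of a generator back to that generator. *)
Lemma cyc_presented_iso : isomorphic (groupF r (br_n_gt0 p) k s) (brace p).
Proof.
set rels := fun v : word 'I_n => exists2 j, j < n & v = iter j (@theta n)
  (cyc_word (br_n_gt0 p) 0 1 r
     ++ word_inv (cyc_word (br_n_gt0 p) (r%:Z + k - 1) 1 s)).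
rewrite /groupF /groupP /cyc_presented -/rels.
have [|phi phiE] := @pres_lift _ rels (brace p) x.
  move=> _ [j j_lt ->]; rewrite eval_relator !block_brace.
  apply/eqP; rewrite divg_eq1; apply/eqP/res_eq.
  rewrite mulnDr expnD -mulnA; apply: eq_muln_mod => //.
  rewrite -(eq_muln_mod (erefl _) rho_c) mulnA -expnD -mulSnr prednK ?br_n_gt0 //.
  by rewrite -[in LHS](mul1n r); apply: eq_muln_mod => //;
     rewrite -(expn0 rho); apply: eq_rho_exp; rewrite modnMr mod0n.
pose X i := pres_class rels (letter (cyc_index (br_n_gt0 p) i%:Z)).
have X_mod i j : i = j %[mod n] -> X i = X j.
  move=> ij; congr (pres_class _ (letter _)); apply: cyc_index_eq.
  by rewrite !modz_nat ij.
have X_rel i : block X i r = block X (i + c) s.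
  have /eqP := eval_rel (ex_intro2 _ _ (i %% n) (ltn_pmod i (br_n_gt0 p)) (erefl _)
    : rels _).
  rewrite eval_relator divg_eq1 => /eqP E.
  rewrite -(block_mod X_mod r (modn_mod i n)).
  rewrite E; apply: (block_mod X_mod s).
  by apply: eq_addn_mod => //; apply: modn_mod.
pose psi (v : brace p) : presented rels := block X 0 (v : 'I_d).
have psi_res v : psi (res p v) = block X 0 v.
  by apply: (block_mod_size (br_n_gt0 p) X_mod rs_mod X_rel (br_n_dvd_d p) d_eq);
    rewrite modn_mod.
have psiM : {morph psi : u v / (u * v)%g}.
  move=> u v; rewrite psi_res /psi.
  by rewrite (block_brace_mul (br_n_gt0 p) X_mod rs_mod X_rel (br_n_dvd_d p) d_eq
     co_rd rho_c (br_rho_exp p) co_cn).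
pose m := isMultiplicative.Build _ _ psi psiM.
pose psi' : {multiplicative brace p -> presented rels} := HB.pack psi m.
apply: (@isomorphic_inj_surj _ _ phi).
  move=> g; rewrite -(pres_reprK g); set w := pres_repr g => phi1.
  have -> : pres_class rels w = psi' (phi (pres_class rels w)).
    rewrite -[RHS]/((psi' \o phi) _) (pres_hom_eval (psi' \o phi)).
    rewrite -eval_pres_class; congr (eval_word _ w); apply: funext => i /=.
    rewrite phiE /= mulg1 psi_res.
    rewrite (block_generator (br_n_gt0 p) X_mod rs_mod X_rel (br_n_dvd_d p) d_eq
       co_rd rho_c (br_rho_exp p) co_cn).
    by rewrite /X cyc_index_ord.
  by rewrite phi1 morph_one.
move=> v; exists (pres_class rels (cyc_word (br_n_gt0 p) 0 1 (v : 'I_d))).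
by rewrite phiE (eval_cyc_word _ _ _ (i := 0)) // block_brace muln0 mul1n resK.
Qed.

End CyclicallyPresentedBrace.

(** * The metacyclic presentation of the brace *)

Section MetacyclicPresentation.
Variables (p : brace_data) (M R lambda : int) (alpha e : nat).
Notation n := (br_n p).
Notation d := (br_d p).
Notation rho := (br_rho p).
Local Notation exponent := (lambda * M %/ gcdz M (R - 1))%Z.
Local Notation m := `|M|%N.
Hypothesis M_def : m * n = d.
Hypothesis R_mod : (R = rho%:Z %[mod M])%Z.
Hypothesis e_mod : (exponent = e%:Z %[mod M])%Z.
Hypothesis co_alpha : coprime alpha d.
(* The image of the relation b^n = a^e under b |-> 1 and a |-> alpha n. *)
Hypothesis alpha_e : e * (alpha * n) = geom p n %[mod d].

Let m_gt0 : 0 < m.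
Proof. by have := br_d_gt0 p; rewrite -M_def; case: m. Qed.

Lemma expgz_eq1 (H : groupType) (x : H) : (expgz x M = 1 <-> x ^+ m = 1)%g.
Proof.
case: M => j //=; rewrite expVgn; split=> [/eqP|->]; last exact: invg1.
by rewrite invg_eq1 => /eqP.
Qed.

(** Negative letters disappear because a and b have finite orders dividing m and
    n m; powers of a then move to the left, and b^n is absorbed into them. *)
Lemma groupB_normal_form (H : groupType) (a b : H) (w : word bool) :
  (a ^+ m = 1 -> b * a = a ^+ rho * b -> b ^+ n = a ^+ e ->
  exists2 ij, ij.1 < m /\ ij.2 < n &
    eval_word (fun x : bool => if x then b else a) w = a ^+ ij.1 * b ^+ ij.2)%g.
Proof.
move=> am ba bn.
have n_gt0 := br_n_gt0 p.
have norm i j : exists2 ij, ij.1 < m /\ ij.2 < n &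
    (a ^+ i * b ^+ j = a ^+ ij.1 * b ^+ ij.2)%g.
  have red i' : (a ^+ i' = a ^+ (i' %% m)%N)%g.
    by rewrite {1}(divn_eq i' m) expgnDr mulnC expgnA am expg1n mul1g.
  exists ((i + e * (j %/ n)) %% m, j %% n); first by rewrite !ltn_pmod.
  rewrite /= -red {1}(divn_eq j n) !expgnDr -mulgA.
  by rewrite (mulnC _ n) expgnA bn -expgnA mulgA.
have baX i : (b * a ^+ i = a ^+ (rho * i)%N * b)%g.
  elim: i => [|i IHi]; first by rewrite muln0 mulg1 mul1g.
  by rewrite expgS mulgA ba -mulgA IHi mulgA -expgnDr mulnS.
have ainv : (a^-1 = a ^+ m.-1)%g.
  by apply: mulg1_eq; rewrite -expgS prednK.
have bX l i : (b ^+ l * a ^+ i = a ^+ (rho ^ l * i)%N * b ^+ l)%g.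
  elim: l => [|l IHl]; first by rewrite mul1n mulg1 mul1g.
  by rewrite !expgS -mulgA IHl mulgA baX mulgA expnS -mulnA.
have binv : (b^-1 = b ^+ (n * m).-1)%g.
  apply: mulg1_eq; rewrite -expgS prednK ?muln_gt0 ?n_gt0 //.
  by rewrite expgnA bn -expgnA mulnC expgnA am expg1n.
elim: w => [|[x ex] w [[i j] /= _ IHw]].
  by exists (0, 0) => //=; rewrite mulg1.
rewrite /= IHw; case: x ex => [] [].
- by rewrite binv mulgA bX -mulgA -expgnDr; apply: norm.
- by rewrite mulgA baX -mulgA -expgS; apply: norm.
- by rewrite ainv mulgA -expgnDr; apply: norm.
- by rewrite mulgA -expgS; apply: norm.
Qed.

(** Injectivity rests on [res_factor1]: among the normal forms only the trivial
    one is sent to 1. *)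
Lemma groupB_iso : isomorphic (groupB M n%:Z R lambda) (brace p).
Proof.
rewrite /groupB; set rels := fun w : word bool => or3 _ _ _.
have evalX (H : groupType) (f : bool -> H) (x : bool) z :
    eval_word f (word_exp (letter x) z) = expgz (f x) z.
  by rewrite eval_exp /= mulg1.
pose f (x : bool) : brace p := if x then res p 1 else res p (alpha * n).
have fam : (f false ^+ m = 1)%g.
  rewrite /= res_expn; apply/res_eq; rewrite mod0n mulnCA M_def.
  exact: modnMl.
have R_modm : (R = rho%:Z %[mod m%:Z])%Z by rewrite !modz_abs.
have e_modm : (exponent = e%:Z %[mod m%:Z])%Z by rewrite !modz_abs.
have [|phi phiE] := @pres_lift _ rels (brace p) f.
  move=> w [] ->.
  - by rewrite evalX; apply/expgz_eq1.
  - rewrite !eval_cat !eval_inv evalX (expgz_eq m_gt0 fam R_modm) /= !mulg1.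
    by rewrite !mulgA res_conj mulgK mulgV.
  - rewrite eval_cat eval_inv !evalX (expgz_eq m_gt0 fam e_modm) /=.
    rewrite res1_exp res_expn; apply/eqP; rewrite divg_eq1; apply/eqP/res_eq.
    by rewrite alpha_e.
pose A : presented rels := pres_class rels (letter false).
pose B : presented rels := pres_class rels (letter true).
have ABE w : pres_class rels w = eval_word (fun x : bool => if x then B else A) w.
  by rewrite -eval_pres_class; congr (eval_word _ w); apply: funext => -[].
have Am : (A ^+ m = 1)%g.
  apply/expgz_eq1; have /eval_rel := Or31 _ _ (erefl _) : rels _.
  by rewrite evalX.
have BA : (B * A = A ^+ rho * B)%g.
  have /eval_rel := Or32 _ _ (erefl _) : rels _.
  rewrite !eval_cat !eval_inv evalX (expgz_eq m_gt0 Am R_modm) /= !mulg1.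
  by rewrite !mulgA => /divg1_eq /eqP; rewrite divg_eq => /eqP.
have Bn : (B ^+ n = A ^+ e)%g.
  have /eval_rel := Or33 _ _ (erefl _) : rels _.
  by rewrite eval_cat eval_inv !evalX (expgz_eq m_gt0 Am e_modm) /= => /divg1_eq.
have phiAB i j : (phi (A ^+ i * B ^+ j) = res p (alpha * n) ^+ i * res p 1 ^+ j)%g.
  have phiX g l : (phi (g ^+ l) = phi g ^+ l)%g.
    by elim: l => [|l IHl]; rewrite ?morph_one // !expgS gmulfM IHl.
  by rewrite gmulfM !phiX !phiE /= !mulg1.
apply: (@isomorphic_inj_surj _ _ phi) => [g | v].
  rewrite -(pres_reprK g) ABE.
  have [[i j] /= [i_lt j_lt] ->] := groupB_normal_form (pres_repr g) Am BA Bn.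
  rewrite phiAB => /(res_factor1 co_alpha j_lt) [-> ].
  rewrite -M_def dvdn_pmul2r ?br_n_gt0 // => /dvdnP[[|t] Et].
    by rewrite Et mulg1.
  by move: i_lt; rewrite Et mulSn ltnNge leq_addr.
have [i [j ->]] := res_factor v co_alpha.
by exists (A ^+ i * B ^+ j)%g.
Qed.

End MetacyclicPresentation.

(** * Arithmetic of r^n - s^n *)

Lemma eq_sum_mod (I : finType) d (F G : I -> nat) :
  (forall i, F i = G i %[mod d]) -> \sum_i F i = \sum_i G i %[mod d].
Proof.
move=> FG; rewrite -modn_summ -[RHS]modn_summ.
by congr (_ %% _); apply: eq_bigr => i _.
Qed.

Lemma inv_mod_coprimel d u v : u * v = 1 %[mod d] -> coprime u d.
Proof.
by move=> uv; have := coprime1n d; rewrite -coprime_modl -uv coprime_modl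
  coprimeMl => /andP[].
Qed.

Lemma eq_natz_mod d (x y : nat) :
  (x%:Z = y%:Z %[mod d%:Z])%Z <-> x = y %[mod d].
Proof. by rewrite !modz_nat; split=> [[]|->]. Qed.

Lemma natz_residue d (z : int) : 0 < d ->
  exists u : nat, (u%:Z = z %[mod d%:Z])%Z.
Proof.
move=> d_gt0; exists `|(z %% d%:Z)%Z|%N.
by rewrite gez0_abs ?modz_mod // modz_ge0 // eqz_nat -lt0n.
Qed.

Lemma dvdz_mod m d (x y : int) :
  (m %| d)%Z -> (x = y %[mod d])%Z -> (x = y %[mod m])%Z.
Proof.
move=> md /eqP; rewrite eqz_mod_dvd => dxy.
by apply/eqP; rewrite eqz_mod_dvd (dvdz_trans md).
Qed.

Definition homog_sum n r s := \sum_(i < n) r ^ (n.-1 - i) * s ^ i.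

Lemma homog_sumE n r s :
  (r%:Z ^+ n - s%:Z ^+ n = (r%:Z - s%:Z) * (homog_sum n r s)%:Z)%R.
Proof.
rewrite subrXX; congr (_ * _)%R; rewrite /homog_sum (big_morph Posz PoszD (erefl _)).
by apply: eq_bigr => i _; rewrite PoszM -!natz !natrX.
Qed.

(** Modulo n the n summands all become r^(n-1). *)
Lemma dvdn_homog_sum n r s : r = s %[mod n] -> n %| homog_sum n r s.
Proof.
move=> rs; rewrite /dvdn -(modnMr (r ^ n.-1) n); apply/eqP.
have -> : n * r ^ n.-1 = \sum_(i < n) r ^ n.-1 by rewrite sum_nat_const card_ord.
rewrite /homog_sum; apply: eq_sum_mod => i.
have Ei : n.-1 = n.-1 - i + i.
  by rewrite subnK // -ltnS prednK // (leq_ltn_trans _ (ltn_ord i)).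
by rewrite [in RHS]Ei expnD; apply/eq_muln_mod/eq_expn_base_mod/esym.
Qed.

Section ExponentArithmetic.
Variables n r s c a rhat rho d : nat.
Hypothesis n_gt0 : 0 < n.
Hypothesis rn_sn : r ^ n = s ^ n %[mod d].
Hypothesis rhat_inv : r * rhat = 1 %[mod d].
Hypothesis ac : a * c = 1 %[mod n].
Hypothesis rho_def : rho = (s * rhat) ^ a %[mod d].

(** Where r = s, the ratio s / r and its powers are 1; used both for n and for
    |r - s|. *)
Lemma rho_mod1 g : g %| d -> r = s %[mod g] -> rho = 1 %[mod g].
Proof.
move=> gd rs; rewrite (eqn_mod_dvd gd rho_def) -[in RHS](exp1n a).
apply: eq_expn_base_mod; rewrite -(eqn_mod_dvd gd rhat_inv).
exact/esym/eq_muln_mod.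
Qed.

Lemma ratio_exp_n : (s * rhat) ^ n = 1 %[mod d].
Proof.
rewrite expnMn -(eq_muln_mod rn_sn (erefl _)) -expnMn.
by rewrite (eq_expn_base_mod _ rhat_inv) exp1n.
Qed.

Lemma rho_exp_mod1 : rho ^ n = 1 %[mod d].
Proof.
rewrite (eq_expn_base_mod _ rho_def) expnAC.
by rewrite (eq_expn_base_mod _ ratio_exp_n) exp1n.
Qed.

Lemma rho_exp_c : rho ^ c * r = s %[mod d].
Proof.
rewrite (eq_muln_mod (eq_expn_base_mod c rho_def) (erefl _)) -expnM.
rewrite (eq_muln_mod (eq_expn_mod ratio_exp_n ac) (erefl _)) expn1.
by rewrite -mulnA (mulnC rhat) (eq_muln_mod (erefl _) rhat_inv) muln1.
Qed.

(** Reindexing by i |-> c i modulo n turns the powers of rho into those of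
    rho^c, which is s / r; multiplication by r^(n-1) clears denominators. *)
Lemma geometric_sum_scaled :
  (\sum_(i < n) rho ^ i) * r ^ n.-1 = homog_sum n r s %[mod d].
Proof.
pose h (i : 'I_n) : 'I_n := Ordinal (ltn_pmod (c * i) n_gt0).
have h_inj : injective h.
  move=> i j [] E; apply: val_inj; rewrite /= -(modn_small (ltn_ord i)).
  rewrite -(modn_small (ltn_ord j)) -(mul1n i) -(mul1n j).
  rewrite -!(eq_muln_mod ac (erefl _)) -!mulnA.
  exact: eq_muln_mod.
rewrite (reindex_inj h_inj) /= big_distrl; apply: eq_sum_mod => i /=.
have -> : n.-1 = n.-1 - i + i by rewrite subnK // -ltnS prednK.
rewrite addnK expnD mulnCA; apply: eq_muln_mod => //.
rewrite (eq_muln_mod (eq_expn_mod rho_exp_mod1 (modn_mod _ _)) (erefl _)).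
by rewrite expnM -expnMn; apply/eq_expn_base_mod/rho_exp_c.
Qed.

End ExponentArithmetic.

Local Open Scope ring_scope.

(** As q^n = 1, a negative exponent -j may be replaced by (n - 1) j. *)
Lemma is_exp_mod_nat (n : nat) (D q A R : int) :
  (0 < n)%N -> (q ^+ n = 1 %[mod D])%Z -> is_exp_mod D q A R ->
  exists2 a : nat, (a%:Z = A %[mod n%:Z])%Z & (R = q ^+ a %[mod D])%Z.
Proof.
move=> n_gt0 qn; case: A => j /= RA; first by exists j.
exists (n.-1 * j.+1)%N.
  apply/eqP; rewrite eqz_mod_dvd NegzE opprK -PoszD -mulSnr prednK //.
  by rewrite PoszM dvdz_mulr.
have E : (q ^+ (n * j.+1) = 1 %[mod D])%Z.
  by rewrite exprM -modzXm qn modzXm expr1n.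
rewrite -[R]mulr1 -modzMmr -E modzMmr -(prednK n_gt0) mulSn exprD mulrA.
by rewrite -modzMml RA modzMml mul1r.
Qed.

(** One divisibility is [rho_mod1] for g = |r - s|; conversely, modulo a common
    divisor of M and R - 1 the relation rho^c r = s becomes r = s. *)
Lemma gcdz_metacyclic_exponent (r s c rho d : nat) (T R M : int) :
  (rho ^ c * r = s %[mod d])%N ->
  (forall g, g %| d -> r = s %[mod g] -> rho = 1 %[mod g])%N ->
  (R = rho%:Z %[mod d%:Z])%Z -> (M %| d%:Z)%Z -> M = (r%:Z - s%:Z) * T ->
  gcdz M (R - 1) = `|r%:Z - s%:Z|.
Proof.
move=> rho_c rho_mod1 R_rho M_d M_def.
have G_d : (gcdz M (R - 1) %| d%:Z)%Z by apply: dvdz_trans (dvdz_gcdl _ _) M_d.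
have R1 g : (g %| d%:Z)%Z -> (rho = 1 %[mod `|g|])%N -> (g %| R - 1)%Z.
  move=> gd rho1; rewrite -eqz_mod_dvd (dvdz_mod gd R_rho).
  by apply/eqP; rewrite -!(modz_abs _ g); apply/eq_natz_mod.
suff E : `|gcdz M (R - 1)|%N = `|r%:Z - s%:Z|%N by rewrite -abszE -E.
have rsE g : (r = s %[mod g])%N <-> (g %| `|r%:Z - s%:Z|)%N.
  rewrite -[X in X <-> _]eq_natz_mod -(dvdzE g%:Z).
  by split=> [/eqP|rs]; [|apply/eqP]; rewrite eqz_mod_dvd.
apply/eqP; rewrite eqn_dvd; apply/andP; split; last first.
  have rs_M : (r%:Z - s%:Z %| M)%Z by rewrite M_def dvdz_mulr.
  rewrite -dvdzE dvdz_gcd.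
  rewrite rs_M R1 ?(dvdz_trans rs_M) //; apply: rho_mod1; last exact/rsE.
  exact: dvdz_trans rs_M M_d.
apply/rsE.
have rho1 : (rho = 1 %[mod `|gcdz M (R - 1)|])%N.
  apply/eq_natz_mod; rewrite -(dvdz_mod G_d R_rho); apply/eqP.
  by rewrite eqz_mod_dvd dvdz_gcdr.
rewrite -(eqn_mod_dvd G_d rho_c) -[in LHS](mul1n r); apply: eq_muln_mod => //.
by rewrite (eq_expn_base_mod c rho1) exp1n.
Qed.

(** * The theorem *)

Theorem corollary12 (n r s : nat) (k : int)
    (n_gt0 : (0 < n)%N) (r_gt0 : (0 < r)%N) (s_gt0 : (0 < s)%N)
    (co_n : coprimez n%:Z (r%:Z + k - 1)) (co_rs : coprime r s)
    (neq_rs : r <> s) (eq_rs : (r = s %[mod n])%N)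
    (A rhat R : int)
    (A_inv : ((r%:Z + k - 1) * A = 1 %[mod n%:Z])%Z)
    (rhat_inv : (r%:Z * rhat = 1 %[mod r%:Z ^+ n - s%:Z ^+ n])%Z)
    (R_exp : is_exp_mod (r%:Z ^+ n - s%:Z ^+ n) (s%:Z * rhat) A R) :
  let D := r%:Z ^+ n - s%:Z ^+ n in
  let M := (D %/ n%:Z)%Z in
  [/\ (n%:Z %| D)%Z,
      (R ^+ n = 1 %[mod M])%Z,
      isomorphic (groupF r n_gt0 k s) (groupB M n%:Z R 1)
    & exists gT : finGroupType,
        [/\ isomorphic (groupF r n_gt0 k s) gT,
            metacyclic [set: gT]
          & #|[set: gT]| = `|D|%N]].
Proof.
move=> D M; rewrite -/D in rhat_inv R_exp.
have natzX (x j : nat) : (x ^ j)%N%:Z = x%:Z ^+ j by rewrite -!natz natrX.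
have D_neq0 : D != 0.
  by rewrite subr_eq0 -!natzX eqz_nat eqn_exp2r //; apply/eqP.
set d := `|D|%N; have d_gt0 : (0 < d)%N by rewrite absz_gt0.
have modD x y : (x = y %[mod D])%Z <-> (x = y %[mod d%:Z])%Z.
  by rewrite !modz_abs.
have n_neq0 : n%:Z != 0 by rewrite eqz_nat -lt0n.
have [T ST] := dvdnP (dvdn_homog_sum eq_rs).
have DE : D = (r%:Z - s%:Z) * T%:Z * n%:Z.
  by rewrite /D homog_sumE ST PoszM mulrA.
have ME : M = (r%:Z - s%:Z) * T%:Z by rewrite /M DE mulzK.
have MnD : M * n%:Z = D by rewrite ME DE.
have n_dvd_D : (n%:Z %| D)%Z by rewrite -MnD dvdz_mull.
have [c cE] := natz_residue (r%:Z + k - 1) n_gt0.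
have [rh rhE] := natz_residue rhat d_gt0.
have [rho rhoE] := natz_residue R d_gt0.
have {}rhat_inv : (r * rh = 1 %[mod d])%N.
  by apply/eq_natz_mod; rewrite PoszM -modzMmr rhE modzMmr; apply/modD.
have d_eq : (r ^ n = s ^ n + d \/ s ^ n = r ^ n + d)%N.
  rewrite /d /D -!natzX.
  case: (leqP (s ^ n) (r ^ n)) => [le | /ltnW le]; [left|right].
    by rewrite subzn // subnKC.
  by rewrite distnC subzn // subnKC.
have rn_sn : (r ^ n = s ^ n %[mod d])%N by case: d_eq => ->; rewrite modnDr.
have [||a aE Ra] := @is_exp_mod_nat n d (s%:Z * rh%:Z) A R n_gt0.
- by rewrite -PoszM -natzX; apply/eq_natz_mod; apply: ratio_exp_n rn_sn rhat_inv.
- have qE : (s%:Z * rh%:Z = s%:Z * rhat %[mod d%:Z])%Z.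
    by rewrite -modzMmr rhE modzMmr.
  case: A R_exp {A_inv} => j /= /modD RA; first by rewrite RA -modzXm -qE modzXm.
  by rewrite -RA -modzMmr -modzXm qE modzXm modzMmr.
have ac : (a * c = 1 %[mod n])%N.
  by apply/eq_natz_mod; rewrite PoszM -modzMm aE cE modzMm mulrC.
have rho_a : (rho = (s * rh) ^ a %[mod d])%N.
  by apply/eq_natz_mod; rewrite natzX PoszM -Ra.
have n_dvd_d : (n %| d)%N by exact: n_dvd_D.
have rho_mod1 := rho_mod1 rhat_inv rho_a.
have rho_n := rho_mod1 _ n_dvd_d eq_rs.
have rho_exp := rho_exp_mod1 rn_sn rhat_inv rho_a.
have rho_c := rho_exp_c rn_sn rhat_inv ac rho_a.
have Ssum := geometric_sum_scaled n_gt0 rn_sn rhat_inv ac rho_a.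
pose p := BraceData n_gt0 d_gt0 n_dvd_d rho_n rho_exp.
have M_dvd_D : (M %| D)%Z by rewrite -MnD dvdz_mulr.
have M_dvd_d : (M %| d%:Z)%Z by exact: M_dvd_D.
have co_rd : coprime r d := inv_mod_coprimel rhat_inv.
have co_cn : coprime c n by apply: (@inv_mod_coprimel n c a); rewrite mulnC.
have isoF : isomorphic (groupF r n_gt0 k s) (brace p).
  exact: (@cyc_presented_iso p r s c k (esym cE)).
have gE := gcdz_metacyclic_exponent rho_c rho_mod1 (esym rhoE) M_dvd_d ME.
(* u represents the sign of r - s, which enters both M / (M, R - 1) and alpha
   and so cancels in the relation for b^n. *)
have [u uE] := natz_residue (sgz (r%:Z - s%:Z)) d_gt0.
have rs_neq0 : r%:Z - s%:Z != 0 by rewrite subr_eq0 eqz_nat; apply/eqP.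
have uu : (u * u = 1 %[mod d])%N.
  by apply/eq_natz_mod; rewrite PoszM -modzMm uE modzMm mulz_sg rs_neq0.
have isoB : isomorphic (groupB M n%:Z R 1) (brace p).
  apply: (@groupB_iso p M R 1 (u * rh ^ n.-1) (u * T)).
  - by rewrite -[br_d p]/`|D|%N -MnD abszM.
  - by apply: dvdz_mod M_dvd_d _.
  - rewrite gE mul1r ME {1}[r%:Z - s%:Z]intEsg mulrAC.
    rewrite mulzK ?eqz_nat ?absz_eq0 // -ME.
    by rewrite PoszM -modzMml (dvdz_mod M_dvd_d uE) modzMml.
  - rewrite coprimeMl (inv_mod_coprimel uu) coprimeXl //.
    by apply: (@inv_mod_coprimel d rh r); rewrite mulnC.
  - have -> : (u * T * (u * rh ^ n.-1 * n)
      = u * u * (homog_sum n r s * rh ^ n.-1))%N.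
      by rewrite ST mulnACA !mulnA !(mulnAC _ (rh ^ n.-1)%N).
    rewrite (eq_muln_mod uu (erefl _)) mul1n.
    rewrite -(eq_muln_mod Ssum (erefl _)) -mulnA -expnMn.
    by rewrite (eq_muln_mod (erefl _) (eq_expn_base_mod _ rhat_inv)) exp1n muln1.
split=> //.
- apply: dvdz_mod M_dvd_d _; rewrite -modzXm -rhoE modzXm -natzX.
  exact/eq_natz_mod.
- exact: isomorphic_trans isoF (isomorphic_sym isoB).
- exists (brace p); split=> //; first exact: brace_metacyclic.
  by rewrite cardsT card_ord.
Qed.
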